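(* Let $S\in\mathbb{R}_+^{X\times Y}$ ($X,Y$ finite) be a matrix in which the set disjointness matrix on $[n]$ can be embedded. Consider a randomized protocol computing $S$ in expectation. If, for every input $(x,y)$ with $S(x,y)>0$, the probability that the protocol outputs a non-zero value on $(x,y)$ is at least $p=p(n)$, then the protocol has complexity $\Omega(np)$. In particular, the complexity of the protocol is $\Omega(n(1-\sigma^2))$, where $\sigma^2$ denotes the normalized variance of the protocol. (The constants hidden in $\Omega$ are absolute.)
   Context: $[n]=\{1,\dots,n\}$. The set disjointness matrix $\mathrm{DISJ}$ on $[n]$ has rows and columns indexed by subsets of $[n]$, with $\mathrm{DISJ}(A,B)=1$ if $A\cap B=\varnothing$ and $\mathrm{DISJ}(A,B)=0$ otherwise. An embedding of the set disjointness matrix on $[n]$ in a matrix $S\in\mathbb{R}_+^{X\times Y}$ is a pair of maps $\alpha:2^{[n]}\to X$, $\beta:2^{[n]}\to Y$ such that for all $A,B\subseteq[n]$: $\mathrm{DISJ}(A,B)=1 \iff S(\alpha(A),\beta(B))=0$. Randomized protocols (with private random bits and nonnegative outputs). A randomized protocol is a rooted binary tree in which each node has a type, $X$ or $Y$. Each internal node $v$ of type $X$ carries functions $p_{0,v},p_{1,v}:X\to[0,1]$ with $p_{0,v}(x)+p_{1,v}(x)\leqslant 1$ for all $x$; each internal node $v$ of type $Y$ carries functions $q_{0,v},q_{1,v}:Y\to[0,1]$ with $q_{0,v}(y)+q_{1,v}(y)\leqslant 1$ for all $y$. Each leaf $v$ of type $X$ carries a nonnegative vector $\Lambda_v\in\mathbb{R}_+^X$,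 and each leaf $v$ of type $Y$ a nonnegative vector $\Lambda_v\in\mathbb{R}_+^Y$. An execution on input $(x,y)\in X\times Y$ is a random path starting at the root: at an internal node $v$ of type $X$ it goes to the left child with probability $p_{0,v}(x)$, to the right child with probability $p_{1,v}(x)$, and stops at $v$ with the remaining probability; at an internal node of type $Y$ it does the same with $q_{0,v}(y),q_{1,v}(y)$ (choices at different nodes being independent). The value (output) of an execution stopping at a leaf $v$ is $\Lambda_v(x)$ if $v$ has type $X$ and $\Lambda_v(y)$ if $v$ has type $Y$; the value of an execution stopping at an internal node is $0$. The protocol computes $S\in\mathbb{R}_+^{X\times Y}$ in expectation if for every $(x,y)$ the expectation of the value $\xi_{x,y}$ of an execution on $(x,y)$ equals $S(x,y)$. The complexity of a protocol is the height of its tree. The normalized variance of a protocol computing $S$ in expectation is $\sigma^2=\max\{\mathrm{Var}(\xi_{x,y}/S(x,y)) : S(x,y)\neq 0\}$. *)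

(* Defs.v *)
From HB Require Import structures.
From mathcomp Require Import all_boot all_order all_algebra reals.

Set Implicit Arguments.
Unset Strict Implicit.
Unset Printing Implicit Defensive.

Import Order.TTheory GRing.Theory Num.Theory.

Local Open Scope ring_scope.

(* Subsets of [n] are represented as {set 'I_n}. *)
Definition DISJ (R : realType) (n : nat) (A B : {set 'I_n}) : R :=
  if A :&: B == set0 then 1 else 0.

Definition embeds_DISJ (R : realType) (X Y : finType) (n : nat)
    (S : X -> Y -> R) : Prop :=
  exists (alpha : {set 'I_n} -> X) (beta : {set 'I_n} -> Y),
    forall A B : {set 'I_n}, DISJ R A B = 1 <-> S (alpha A) (beta B) = 0.

(* The constraints on the labels are imposed separately by is_protocol below.
   In XNode p0 p1 l r, p0 is the probability of moving to the left child l and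
   p1 that of moving to the right child r. *)
Inductive ptree (R : realType) (X Y : finType) : Type :=
  | XLeaf (Lambda : X -> R)
  | YLeaf (Lambda : Y -> R)
  | XNode (p0 p1 : X -> R) (l r : ptree R X Y)
  | YNode (q0 q1 : Y -> R) (l r : ptree R X Y).

Definition transition_pair (R : realType) (Z : finType) (p0 p1 : Z -> R) :
    Prop :=
  forall z, [/\ 0 <= p0 z <= 1, 0 <= p1 z <= 1 & p0 z + p1 z <= 1].

Fixpoint is_protocol (R : realType) (X Y : finType) (t : ptree R X Y) : Prop :=
  match t with
  | XLeaf L => forall x, 0 <= L x
  | YLeaf L => forall y, 0 <= L y
  | XNode p0 p1 l r => [/\ transition_pair p0 p1, is_protocol l & is_protocol r]
  | YNode q0 q1 l r => [/\ transition_pair q0 q1, is_protocol l & is_protocol r]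
  end.

Fixpoint height (R : realType) (X Y : finType) (t : ptree R X Y) : nat :=
  match t with
  | XLeaf _ | YLeaf _ => 0
  | XNode _ _ l r | YNode _ _ l r => (maxn (height l) (height r)).+1
  end.

(* An execution is a path from the root to the node at which it stops. It is
   encoded by its sequence of moves (false = left, true = right), so the
   executions of t correspond to the nodes of t, leaves and internal nodes
   alike. *)
Fixpoint executions (R : realType) (X Y : finType) (t : ptree R X Y) :
    seq (seq bool) :=
  match t with
  | XLeaf _ | YLeaf _ => [:: [::]]
  | XNode _ _ l r | YNode _ _ l r =>
      [::] :: map (cons false) (executions l) ++ map (cons true) (executions r)
  end.

(* Paths leaving the tree get probability 0. *)
Fixpoint exec_prob (R : realType) (X Y : finType) (t : ptree R X Y)
    (x : X) (y : Y) (e : seq bool) {struct t} : R :=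
  match t, e with
  | XLeaf _, [::] | YLeaf _, [::] => 1
  | XLeaf _, _ :: _ | YLeaf _, _ :: _ => 0
  | XNode p0 p1 l r, [::] => 1 - p0 x - p1 x
  | XNode p0 p1 l r, false :: e' => p0 x * exec_prob l x y e'
  | XNode p0 p1 l r, true :: e' => p1 x * exec_prob r x y e'
  | YNode q0 q1 l r, [::] => 1 - q0 y - q1 y
  | YNode q0 q1 l r, false :: e' => q0 y * exec_prob l x y e'
  | YNode q0 q1 l r, true :: e' => q1 y * exec_prob r x y e'
  end.

(* The random variable xi_{x,y}. *)
Fixpoint exec_value (R : realType) (X Y : finType) (t : ptree R X Y)
    (x : X) (y : Y) (e : seq bool) {struct t} : R :=
  match t, e with
  | XLeaf L, [::] => L x
  | YLeaf L, [::] => L y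
  | XLeaf _, _ :: _ | YLeaf _, _ :: _ => 0
  | XNode _ _ _ _, [::] | YNode _ _ _ _, [::] => 0
  | XNode _ _ l r, b :: e' | YNode _ _ l r, b :: e' =>
      exec_value (if b then r else l) x y e'
  end.

Definition exec_Pr (R : realType) (X Y : finType) (t : ptree R X Y)
    (x : X) (y : Y) (E : pred (seq bool)) : R :=
  \sum_(e <- executions t | E e) exec_prob t x y e.

Definition exec_E (R : realType) (X Y : finType) (t : ptree R X Y)
    (x : X) (y : Y) (Z : seq bool -> R) : R :=
  \sum_(e <- executions t) exec_prob t x y e * Z e.

Definition exec_Var (R : realType) (X Y : finType) (t : ptree R X Y)
    (x : X) (y : Y) (Z : seq bool -> R) : R :=
  exec_E t x y (fun e => (Z e - exec_E t x y Z) ^+ 2).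

Definition computes_in_expectation (R : realType) (X Y : finType)
    (t : ptree R X Y) (S : X -> Y -> R) : Prop :=
  forall x y, exec_E t x y (exec_value t x y) = S x y.

(* As variances are nonnegative, the base value 0 of the iterated maximum only
   matters when S is identically 0. *)
Definition normalized_variance (R : realType) (X Y : finType)
    (t : ptree R X Y) (S : X -> Y -> R) : R :=
  \big[Num.max/0]_(xy : X * Y | S xy.1 xy.2 != 0)
    exec_Var t xy.1 xy.2 (fun e => exec_value t xy.1 xy.2 e / S xy.1 xy.2).

(* Main.v *)
Require Import Defs.
From mathcomp Require Import all_boot all_order all_algebra reals exp ring lra.

Set Implicit Arguments.
Unset Strict Implicit.
Unset Printing Implicit Defensive.

Import Order.TTheory GRing.Theory Num.Theory.

Local Open Scope ring_scope.

(** The probability of stopping at a given node with value 0 is a product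
    F(x) G(y), so the probability q of output 0 is a sum of N <= 2^(h+1)
    nonnegative rank-one matrices; on the embedded copy of DISJ it is 1 on
    disjoint pairs and at most 1 - p on intersecting ones.

    Draw a uniform set T, then independent uniform sets A in T and B in the
    complement of T.  As q(A,B) = 1, the terms f_v(A) g_v(B) are the
    distribution of a random index v, which carries at most ln N of
    information about A (or B) given T, spread over the n coordinates.  Fix a
    coordinate i and let a_0, a_1 (b_0, b_1) be the conditional means of f_v
    (g_v) given i notin A, i in A (i notin B, i in B).  Summing
    - (a_1 - a_0)(b_1 - b_0) over v gives 1 + 1 - 1 - q with q <= 1 - p, hence
    at least p, while each term is at most a constant times the information
    b_0 (a_1 - a_0)^2 / (a_0 + a_1) + a_0 (b_1 - b_0)^2 / (b_0 + b_1) on the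
    coordinate i.  Summing over i yields n p = O(ln N).

    For the variance bound, an execution of value 0 contributes 1 to the
    normalized variance, so p = 1 - sigma^2 is admissible. *)

(** * Logarithm inequalities *)

Lemma ln_leB1 (R : realType) (x : R) : 0 < x -> ln x <= x - 1.
Proof.
move=> x_gt0; have -> : ln x = ln (1 + (x - 1)) by congr ln; ring.
by apply: le_ln1Dx; lra.
Qed.

(** Apply [ln z <= z - 1] to [z = (1 + x)^-1]; clearing denominators leaves [x^2 (1 + 2x) >= 0],
    whence the range of [x]. *)
Lemma ln1D_ge (R : realType) (x : R) :
  - (1 / 2) <= x -> x - 2 * x ^+ 2 <= ln (1 + x).
Proof.
move=> hx; have x1_gt0 : 0 < 1 + x by lra.
have : ln (1 + x)^-1 <= (1 + x)^-1 - 1 by rewrite ln_leB1 ?invr_gt0.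
rewrite lnV ?posrE // => lnV_le.
suff : x - 2 * x ^+ 2 <= 1 - (1 + x)^-1 by lra.
have -> : 1 - (1 + x)^-1 = x / (1 + x) by field; lra.
by rewrite ler_pdivlMr //; nra.
Qed.

Lemma ln_prod (R : realType) (I : finType) (F : I -> R) :
  (forall i, 0 < F i) -> ln (\prod_i F i) = \sum_i ln (F i).
Proof.
move=> F_gt0.
suff [] : 0 < \prod_i F i /\ ln (\prod_i F i) = \sum_i ln (F i) by [].
elim/big_rec2: _ => [|i x y _ [y_gt0 <-]]; first by rewrite ln1.
by rewrite mulr_gt0 // lnM ?posrE.
Qed.

(** * Uniform averages over the subsets of [n] *)

Section Mean.
Context {R : realType} {n : nat}.
Implicit Types (F G : {set 'I_n} -> R) (i : 'I_n) (T : {set 'I_n}).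

Definition mean F : R := (\sum_A F A) / 2 ^+ n.

Lemma mean_cst (c : R) : mean (fun=> c) = c.
Proof.
have card_set : #|{set 'I_n}| = (2 ^ n)%N.
  by rewrite -cardsT -powersetT card_powerset cardsT card_ord.
by rewrite /mean sumr_const card_set -[c *+ _]mulr_natr natrX mulfK // expf_neq0 ?pnatr_eq0.
Qed.

Lemma eq_mean F G : F =1 G -> mean F = mean G.
Proof. by move=> FG; rewrite /mean (eq_bigr G). Qed.

Lemma meanZ (c : R) F : mean (fun A => c * F A) = c * mean F.
Proof. by rewrite /mean -mulr_sumr mulrA. Qed.

Lemma meanZr (c : R) F : mean (fun A => F A * c) = mean F * c.
Proof. by rewrite /mean -mulr_suml mulrAC. Qed.

Lemma meanD F G : mean (fun A => F A + G A) = mean F + mean G.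
Proof. by rewrite /mean big_split mulrDl. Qed.

Lemma mean_sum (I : Type) (r : seq I) (F : I -> {set 'I_n} -> R) :
  mean (fun A => \sum_(v <- r) F v A) = \sum_(v <- r) mean (F v).
Proof. by rewrite /mean exchange_big mulr_suml. Qed.

Lemma ler_mean F G : (forall A, F A <= G A) -> mean F <= mean G.
Proof.
by move=> FG; rewrite ler_pM2r ?invr_gt0 ?exprn_gt0 // ler_sum.
Qed.

Lemma mean_ge0 F : (forall A, 0 <= F A) -> 0 <= mean F.
Proof. by move=> F0; rewrite -(mean_cst 0); apply: ler_mean. Qed.

(** Up to sign, the Fourier character of the coordinate [i]; its correlation with a density measures
    the bias of [i]. *)
Definition chi i T : R := if i \in T then 1 else -1.

Lemma norm_mean_chi i F : (forall A, 0 <= F A) ->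
  `|mean (fun A => chi i A * F A)| <= mean F.
Proof.
move=> F0; rewrite ler_norml -mulN1r -meanZ; apply/andP; split;
  by apply: ler_mean => A; rewrite /chi; case: ifP => _; have := F0 A; lra.
Qed.

Definition flip i T : {set 'I_n} := if i \in T then T :\ i else i |: T.

Lemma flipK i : involutive (flip i).
Proof.
move=> T; rewrite /flip; case: (boolP (i \in T)) => iT.
  by rewrite setD11 setD1K.
by rewrite setU11 setU1K.
Qed.

Lemma mean_flip i F : mean (fun A => F (flip i A)) = mean F.
Proof. by rewrite /mean [in RHS](reindex_inj (inv_inj (flipK i))). Qed.

(** Pair [A] with [flip i A]: one of the two is [A :\ i], the other [i |: A]. *)
Lemma mean_split i F :
  mean F = (mean (fun A => F (A :\ i)) + mean (fun A => F (i |: A))) / 2.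
Proof.
have : mean F + mean F = mean (fun A => F (A :\ i)) + mean (fun A => F (i |: A)).
  rewrite -[X in _ + X](mean_flip i) -!meanD; apply: eq_mean => A.
  rewrite /flip; case: ifP => iA.
    by rewrite addrC (setUidPr _) ?sub1set.
  by rewrite (setDidPl _) // disjoint_sym disjoints1 iA.
lra.
Qed.

End Mean.

(** * Information carried by a random index *)

Section Information.
Context {R : realType} {n : nat}.

(* Jensen's inequality for [ln]: the [P v] are the conditional probabilities of an
   index [v], and each [Q v] below is a product density tilted towards the biases
   [t v i] of [P v], so that the mean of [\sum_v P v * Q v] is at most [size r].
   The tilt is only [t v i / 4] to keep the factors of [Q v] away from 0. *)
Lemma information_bound (I : eqType) (r : seq I) (P : I -> {set 'I_n} -> R) :
    (forall v A, 0 <= P v A) -> (forall A, \sum_(v <- r) P v A = 1) ->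
  \sum_(v <- r) \sum_i mean (fun A => chi i A * P v A) ^+ 2 / mean (P v)
    <= 8 * ln (size r)%:R.
Proof.
move=> P0 P1; set N : R := (size r)%:R.
have N_gt0 : 0 < N.
  rewrite ltr0n lt0n; apply/eqP => /size0nil r0.
  by have := P1 set0; rewrite r0 big_nil; lra.
pose m v := mean (P v); pose s v i := mean (fun A => chi i A * P v A).
pose t v i := s v i / m v.
have m0 v : 0 <= m v by apply: mean_ge0.
have sm v i : `|s v i| <= m v by apply: norm_mean_chi.
(* If [m v = 0], then [s v i = 0] by [sm], and both sides vanish. *)
have stm v i : s v i = t v i * m v.
  rewrite /t; have [mv0|mv] := eqVneq (m v) 0; last by rewrite divfK.
  by have := sm v i; rewrite mv0 mulr0 normr_le0 => /eqP.
have t1 v i : `|t v i| <= 1.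
  rewrite /t; have [mv0|mv] := eqVneq (m v) 0; first by rewrite mv0 invr0 mulr0 normr0.
  by rewrite normrM normfV (ger0_norm (m0 v)) ler_pdivrMr ?mul1r // lt_def mv m0.
pose u v i A := 1 + t v i * chi i A / 4.
pose Q v A := \prod_i u v i A.
have u_ge v i (A : {set 'I_n}) : - (1 / 2) <= t v i * chi i A / 4.
  have := t1 v i; rewrite ler_norml /chi => /andP[? ?]; case: ifP => _; lra.
have u_gt0 v i A : 0 < u v i A by have := u_ge v i A; rewrite /u; lra.
have Q_gt0 v A : 0 < Q v A by apply: prodr_gt0.
have meanQ v : mean (Q v) = 1.
  suff QE : \sum_A Q v A = 2 ^+ n by rewrite /mean QE divff ?expf_neq0 ?pnatr_eq0.
  (* Expanding this product picks a sign at each coordinate, that is, a set [A]; each factor equals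
     2. *)
  transitivity (\prod_(i < n) ((1 + t v i / 4) + (1 - t v i / 4))).
    rewrite bigA_distr; apply: eq_bigr => A _; apply: eq_bigr => i _.
    by rewrite /u /chi; case: ifP => _; field.
  under eq_bigr do rewrite addrACA subrr addr0.
  by rewrite prodr_const card_ord.
(* [ln1D_ge] at [x = t v i * chi i A / 4] bounds the left side by [ln (Q v A)]; then [ln z <= z - 1]
   is used at [z = Q v A / N]. *)
have lnQ v A : \sum_i (t v i * chi i A / 4 - t v i ^+ 2 / 8) <= ln N + Q v A / N - 1.
  apply: (@le_trans _ _ (ln (Q v A))).
    rewrite ln_prod //; apply: ler_sum => i _.
    apply: le_trans (ln1D_ge (u_ge v i A)).
    by rewrite /chi; case: ifP => _; lra.
  have := ln_leB1 (divr_gt0 (Q_gt0 v A) N_gt0).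
  by rewrite ln_div ?posrE //; lra.
(* As [s = t m], each mean on the right is [t^2 m / 4 - t^2 m / 8 = t^2 m / 8]: this is the source
   of the factor 8. *)
have lhsE : \sum_(v <- r) \sum_i s v i ^+ 2 / m v =
    8 * mean (fun A => \sum_(v <- r)
      P v A * \sum_i (t v i * chi i A / 4 - t v i ^+ 2 / 8)).
  rewrite mean_sum mulr_sumr; apply: eq_bigr => v _.
  under [in RHS]eq_mean do rewrite mulr_sumr.
  rewrite mean_sum mulr_sumr; apply: eq_bigr => i _.
  have -> : mean (fun A => P v A * (t v i * chi i A / 4 - t v i ^+ 2 / 8)) =
            t v i / 4 * s v i + - (t v i ^+ 2 / 8) * m v.
    rewrite /s /m -!meanZ -meanD; apply: eq_mean => A; ring.
  have -> : s v i ^+ 2 / m v = s v i * t v i by rewrite /t; ring.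
  by rewrite stm; move: (t v i) (m v) => a b; field.
have P_le1 v A : v \in r -> P v A <= 1.
  move=> vr; rewrite -(P1 A) (big_rem _ vr) /= lerDl; exact: sumr_ge0.
rewrite lhsE ler_pM2l //.
apply: (@le_trans _ _ (mean (fun A => (ln N - 1) + \sum_(v <- r) N^-1 * Q v A))).
  apply: ler_mean => A.
  have -> : ln N - 1 = \sum_(v <- r) (ln N - 1) * P v A.
    by rewrite -mulr_sumr P1 mulr1.
  rewrite -big_split /=.
  rewrite big_seq [leRHS]big_seq; apply: ler_sum => v vr.
  apply: le_trans (ler_wpM2l (P0 v A) (lnQ v A)) _.
  have : P v A * (Q v A / N) <= 1 * (Q v A / N).
    by rewrite ler_wpM2r ?P_le1 // divr_ge0 // ltW.
  lra.
rewrite meanD mean_cst mean_sum.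
under eq_bigr do rewrite meanZ meanQ mulr1.
rewrite big_const_seq count_predT iter_addr_0 -[N^-1 *+ _]mulr_natl mulfV ?gt_eqF //.
lra.
Qed.

End Information.

(** * An inequality for products of differences *)

Lemma cross_le_opposite (R : realFieldType) (a0 a1 b0 b1 : R) :
    0 <= a0 < a1 -> 0 <= b1 < b0 ->
  - ((a1 - a0) * (b1 - b0)) <=
    3 * (b0 * ((a1 - a0) ^+ 2 / (a0 + a1)) + a0 * ((b1 - b0) ^+ 2 / (b0 + b1))).
Proof.
move=> /andP[a0_ge0 a01] /andP[b1_ge0 b10].
set X := (a1 - a0) ^+ 2 / _; set Y := (b1 - b0) ^+ 2 / _.
have XE : X * (a0 + a1) = (a1 - a0) ^+ 2 by rewrite divfK //; lra.
have YE : Y * (b0 + b1) = (b1 - b0) ^+ 2 by rewrite divfK //; lra.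
have X_ge0 : 0 <= X by rewrite divr_ge0 ?sqr_ge0 //; lra.
have Y_ge0 : 0 <= Y by rewrite divr_ge0 ?sqr_ge0 //; lra.
clearbody X Y.
have a0Y : 0 <= a0 * Y by rewrite mulr_ge0.
have [le_a|lt_a] := leP (a1 - a0) a0; last first.
  (* Here [a0 + a1 <= 3 (a1 - a0)], and the term in [X] alone suffices. *)
  have : a1 - a0 <= 3 * X.
    rewrite -(@ler_pM2r _ (a1 - a0)); last lra.
    by rewrite -expr2 -XE -mulrA mulrCA ler_wpM2l //; lra.
  have b0_ge0 : 0 <= b0 by lra.
  move=> /(ler_wpM2l b0_ge0).
  have : 0 <= (a1 - a0) * b1 by rewrite mulr_ge0 //; lra.
  lra.
(* AM-GM on [3 * b0 * X] and [2 * a0 * Y], whose product is at least the square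
   of the left-hand side. *)
have X3 : (a1 - a0) ^+ 2 <= 3 * a0 * X by rewrite -XE mulrC ler_wpM2r //; lra.
have Y2 : (b1 - b0) ^+ 2 <= 2 * b0 * Y by rewrite -YE mulrC ler_wpM2r //; lra.
have XY : ((a1 - a0) * (b1 - b0)) ^+ 2 <= (3 * b0 * X) * (2 * a0 * Y).
  have -> : 3 * b0 * X * (2 * a0 * Y) = 3 * a0 * X * (2 * b0 * Y) by ring.
  rewrite exprMn.
  by rewrite ler_pM // sqr_ge0.
have bX : 0 <= 3 * b0 * X by rewrite !mulr_ge0 //; lra.
have aY : 0 <= 2 * a0 * Y by rewrite !mulr_ge0 //; lra.
have := sqr_ge0 (3 * b0 * X - 2 * a0 * Y); move: XY bX aY a0Y.
have -> : 3 * (b0 * X + a0 * Y) = 3 * b0 * X + 2 * a0 * Y + a0 * Y by ring.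
move: (3 * b0 * X) (2 * a0 * Y) ((a1 - a0) * (b1 - b0)) => u w q.
move=> q_le u_ge0 w_ge0 a0Y_ge0 uw_ge0.
suff : - q <= u + w by lra.
have s_ge0 : 0 <= u + w by rewrite addr_ge0.
have sq : q ^+ 2 <= (u + w) ^+ 2 by have := sqr_ge0 q; lra.
by rewrite leNgt; apply/negP => lt_q; nra.
Qed.

(** Only increments of opposite signs make the left side positive, and the two such cases differ by
    exchanging [a] and [b]. *)
Lemma cross_le (R : realFieldType) (a0 a1 b0 b1 : R) :
    0 <= a0 -> 0 <= a1 -> 0 <= b0 -> 0 <= b1 ->
  - ((a1 - a0) * (b1 - b0)) <=
    3 * (b0 * ((a1 - a0) ^+ 2 / (a0 + a1)) + a0 * ((b1 - b0) ^+ 2 / (b0 + b1))).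
Proof.
move=> a00 a10 b00 b10.
have rhs_ge0 : 0 <= b0 * ((a1 - a0) ^+ 2 / (a0 + a1))
                  + a0 * ((b1 - b0) ^+ 2 / (b0 + b1)).
  by rewrite addr_ge0 // mulr_ge0 // divr_ge0 ?sqr_ge0 ?addr_ge0.
have [ab_ge0|ab_lt0] := leP 0 ((a1 - a0) * (b1 - b0)); first by lra.
have [a01|a10'|a01] := ltgtP a0 a1; last by rewrite a01 subrr mul0r ltxx in ab_lt0.
  by apply: cross_le_opposite; rewrite ?a00 ?b10 //; nra.
have [b0_lt a1_lt] : b0 < b1 /\ a1 < a0 by split => //; nra.
by have := @cross_le_opposite R b0 b1 a0 a1; rewrite b00 a10 b0_lt a1_lt; lra.
Qed.

(** * The information bound for unique disjointness *)

Section Disjointness.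
Context {R : realType} {n : nat}.
Implicit Types (f g : {set 'I_n} -> R) (i : 'I_n) (T : {set 'I_n}).

(* [lo] and [hi] average [f] over the subsets of [T] with the membership of [i]
   forced to be false, resp. true, whether or not [i \in T]. *)
Definition lo f T i : R := mean (fun A => f ((A :&: T) :\ i)).
Definition hi f T i : R := mean (fun A => f (i |: (A :&: T))).

Lemma lo_ge0 f T i : (forall A, 0 <= f A) -> 0 <= lo f T i.
Proof. by move=> f0; apply: mean_ge0. Qed.

Lemma hi_ge0 f T i : (forall A, 0 <= f A) -> 0 <= hi f T i.
Proof. by move=> f0; apply: mean_ge0. Qed.

Lemma lo_setD1 f T i : lo f (T :\ i) i = lo f T i.
Proof.
apply: eq_mean => A; congr f; apply/setP => j; rewrite !inE.
by case: eqP; rewrite ?andbF.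
Qed.

Lemma hi_setD1 f T i : hi f (T :\ i) i = hi f T i.
Proof.
apply: eq_mean => A; congr f; apply/setP => j; rewrite !inE.
by case: eqP; rewrite ?andbF.
Qed.

Lemma lo_setU1 f T i : lo f (i |: T) i = lo f T i.
Proof.
apply: eq_mean => A; congr f; apply/setP => j; rewrite !inE.
by case: eqP; rewrite ?andbF.
Qed.

Lemma hi_setU1 f T i : hi f (i |: T) i = hi f T i.
Proof.
apply: eq_mean => A; congr f; apply/setP => j; rewrite !inE.
by case: eqP; rewrite ?andbF.
Qed.

Lemma lo_notin f T i : i \notin T -> lo f T i = mean (fun A => f (A :&: T)).
Proof.
move=> iT; apply: eq_mean => A; congr f; apply/setP => j; rewrite !inE.
by case: eqP => // ->; rewrite (negbTE iT) andbF.
Qed.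

Lemma mean_setI f T i : i \in T ->
  mean (fun A => f (A :&: T)) = (lo f T i + hi f T i) / 2.
Proof.
move=> iT; rewrite (mean_split i); congr ((_ + _) / _); apply: eq_mean => A;
  congr f; apply/setP => j; rewrite !inE; case: eqP => // ->; by rewrite iT.
Qed.

Lemma mean_chi_setI f T i : i \in T ->
  mean (fun A => chi i A * f (A :&: T)) = (hi f T i - lo f T i) / 2.
Proof.
move=> iT; rewrite (mean_split i) -[lo f T i]mul1r -mulNr -!meanZ addrC.
rewrite -[hi f T i]mul1r -meanZ.
congr ((_ + _) / _); apply: eq_mean => A; congr (_ * f _);
  rewrite /chi ?setU11 ?setD11 //; apply/setP => j; rewrite !inE;
  case: eqP => // ->; by rewrite iT.
Qed.

(** Averaging [g v] over the subsets of [~: T] makes [f v (A :&: T) * b v] a distribution on [v] for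
    every [A], to which [information_bound] applies. *)
Lemma conditional_information_bound (I : eqType) (r : seq I)
    (f g : I -> {set 'I_n} -> R) T :
    (forall v A, 0 <= f v A) -> (forall v B, 0 <= g v B) ->
    (forall A B, A :&: B = set0 -> \sum_(v <- r) f v A * g v B = 1) ->
  \sum_(v <- r) \sum_(i in T) lo (g v) (~: T) i *
      ((hi (f v) T i - lo (f v) T i) ^+ 2 / (lo (f v) T i + hi (f v) T i))
    <= 16 * ln (size r)%:R.
Proof.
move=> f0 g0 fg1.
pose b v := mean (fun B => g v (B :&: ~: T)).
have b0 v : 0 <= b v by apply: mean_ge0.
have P1 A : \sum_(v <- r) f v (A :&: T) * b v = 1.
  under eq_bigr do rewrite -meanZ.
  rewrite -mean_sum -[RHS](@mean_cst R n 1); apply: eq_mean => B; apply: fg1.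
  by rewrite setIACA setICr setI0.
have := @information_bound R n I r (fun v A => f v (A :&: T) * b v)
  (fun v A => mulr_ge0 (f0 _ _) (b0 v)) P1.
(* For [i \in T] the term supplied is [((h - l) b / 2)^2 / ((l + h) b / 2)], half of the required
   one; hence 16 = 2 * 8. *)
move=> /(ler_wpM2l (ler0n R 2)); rewrite mulrA -natrM; apply: le_trans.
rewrite mulr_sumr; apply: ler_sum => v _; rewrite mulr_sumr big_mkcond /=.
apply: ler_sum => i _; rewrite meanZr.
have -> : mean (fun A => chi i A * (f v (A :&: T) * b v)) =
          mean (fun A => chi i A * f v (A :&: T)) * b v.
  by rewrite -meanZr; apply: eq_mean => A; rewrite mulrA.
case: ifP => iT; last first.
  by rewrite mulr_ge0 // divr_ge0 ?sqr_ge0 // mulr_ge0 // mean_ge0.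
rewrite (mean_setI _ iT) (mean_chi_setI _ iT) lo_notin ?inE ?iT // -/(b v).
move: (hi _ _ _) (lo _ _ _) => h l.
have [->|bv] := eqVneq (b v) 0.
  by rewrite !(mulr0, mul0r) expr0n /= mul0r mulr0.
have [->|hl] := eqVneq (l + h) 0; first by rewrite !(invr0, mulr0, mul0r).
by rewrite le_eqVlt; apply/orP; left; apply/eqP; field; rewrite bv hl.
Qed.

(** [G] ignores whether [i] lies in [T], and half of all [T] contain [i]. This lifts the restriction
    [i \in T] of the conditional bound. *)
Lemma mean_in i (G : {set 'I_n} -> R) : (forall T, G (i |: T) = G T) ->
  mean (fun T => if i \in T then G T else 0) = mean G / 2.
Proof.
move=> GU; rewrite (mean_split i).
under eq_mean do rewrite setD11.
under [X in _ + X]eq_mean do rewrite setU11 GU.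
by rewrite mean_cst add0r.
Qed.

Lemma mean_notin i (G : {set 'I_n} -> R) : (forall T, G (T :\ i) = G T) ->
  mean (fun T => if i \in ~: T then G T else 0) = mean G / 2.
Proof.
move=> GD; rewrite (mean_split i).
under eq_mean do rewrite in_setC setD11 GD.
under [X in _ + X]eq_mean do rewrite in_setC setU11.
by rewrite mean_cst addr0.
Qed.

Lemma unique_disjointness_bound (I : eqType) (r : seq I)
    (f g : I -> {set 'I_n} -> R) (p : R) :
    (forall v A, 0 <= f v A) -> (forall v B, 0 <= g v B) ->
    (forall A B, A :&: B = set0 -> \sum_(v <- r) f v A * g v B = 1) ->
    (forall A B i, A :&: B = [set i] ->
      \sum_(v <- r) f v A * g v B <= 1 - p) ->
  n%:R * p <= 192 * ln (size r)%:R.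
Proof.
move=> f0 g0 fg1 fgp.
have gf1 A B : A :&: B = set0 -> \sum_(v <- r) g v A * f v B = 1.
  by rewrite setIC => /fg1 <-; apply: eq_bigr => v _; rewrite mulrC.
pose D f T i := (hi f T i - lo f T i) ^+ 2 / (lo f T i + hi f T i).
pose K i T := \sum_(v <- r) lo (g v) (~: T) i * D (f v) T i.
pose L i T := \sum_(v <- r) lo (f v) T i * D (g v) (~: T) i.
(* This holds for every [T]: the pairs averaged in lo/lo, hi/lo and lo/hi are disjoint, while those
   in hi/hi meet exactly in [i], which is forced into both sets. *)
have p_le i T : p <= 3 * (K i T + L i T).
  have meanM (F G : {set 'I_n} -> R) :
      mean F * mean G = mean (fun A => mean (fun B => F A * G B)).
    by rewrite -meanZr; apply: eq_mean => A; rewrite meanZ.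
  have sum1 (F G : {set 'I_n} -> {set 'I_n}) :
      (forall A B, F A :&: G B = set0) ->
      \sum_(v <- r) mean (fun A => f v (F A)) * mean (fun B => g v (G B)) = 1.
    move=> FG; under eq_bigr do rewrite meanM.
    rewrite -mean_sum -[RHS](@mean_cst R n 1); apply: eq_mean => A.
    by rewrite -mean_sum -[RHS](@mean_cst R n 1); apply: eq_mean => B; rewrite fg1.
  have sump : \sum_(v <- r) hi (f v) T i * hi (g v) (~: T) i <= 1 - p.
    under eq_bigr do rewrite meanM.
    rewrite -mean_sum -[leRHS](@mean_cst R n); apply: ler_mean => A.
    rewrite -mean_sum -[leRHS](@mean_cst R n); apply: ler_mean => B.
    apply: (fgp _ _ i); apply/setP => j; rewrite !inE.
    by case: eqP => //= _; case: (j \in T); rewrite ?andbF.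
  have s00 : \sum_(v <- r) lo (f v) T i * lo (g v) (~: T) i = 1.
    apply: sum1 => A B; apply/setP => j; rewrite !inE.
    by case: (j \in T); rewrite ?andbF.
  have s10 : \sum_(v <- r) hi (f v) T i * lo (g v) (~: T) i = 1.
    apply: sum1 => A B; apply/setP => j; rewrite !inE.
    by case: eqP => //= _; case: (j \in T); rewrite ?andbF.
  have s01 : \sum_(v <- r) lo (f v) T i * hi (g v) (~: T) i = 1.
    apply: sum1 => A B; apply/setP => j; rewrite !inE.
    by case: eqP => //= _; case: (j \in T); rewrite ?andbF.
  apply: (@le_trans _ _ (\sum_(v <- r)
     - ((hi (f v) T i - lo (f v) T i) *
        (hi (g v) (~: T) i - lo (g v) (~: T) i)))).
    under eq_bigr do rewrite mulrBl !mulrBr !opprB addrC addrA.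
    rewrite !(sumrB, big_split) /=; lra.
  rewrite -big_split mulr_sumr; apply: ler_sum => v _.
  by apply: cross_le; rewrite ?lo_ge0 ?hi_ge0.
have meanK : \sum_i mean (K i) <= 32 * ln (size r)%:R.
  have KE i : mean (K i) = 2 * mean (fun T => if i \in T then K i T else 0).
    rewrite mean_in => [|T]; first by field.
    apply: eq_bigr => v _.
    by rewrite /D lo_setU1 hi_setU1 setCU setIC -setDE lo_setD1.
  under eq_bigr do rewrite KE.
  have -> : 32 = 2 * 16 :> R by rewrite -natrM.
  rewrite -mulr_sumr -mean_sum -mulrA ler_pM2l //.
  rewrite -[leRHS](@mean_cst R n); apply: ler_mean => T.
  rewrite -big_mkcond exchange_big /=.
  exact: conditional_information_bound.
have meanL : \sum_i mean (L i) <= 32 * ln (size r)%:R.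
  have LE i : mean (L i) = 2 * mean (fun T => if i \in ~: T then L i T else 0).
    rewrite mean_notin => [|T]; first by field.
    apply: eq_bigr => v _.
    by rewrite /D lo_setD1 setDE setCI setCK setUC lo_setU1 hi_setU1.
  under eq_bigr do rewrite LE.
  have -> : 32 = 2 * 16 :> R by rewrite -natrM.
  rewrite -mulr_sumr -mean_sum -mulrA ler_pM2l //.
  rewrite -[leRHS](@mean_cst R n); apply: ler_mean => T.
  rewrite -big_mkcond exchange_big /=.
  (* The same bound with [f] and [g], and [T] and [~: T], exchanged. *)
  have := @conditional_information_bound I r g f (~: T) g0 f0 gf1.
  by rewrite setCK.
have : \sum_(i < n) p <= \sum_i 3 * (mean (K i) + mean (L i)).
  apply: ler_sum => i _; rewrite -meanD -meanZ -[leLHS](@mean_cst R n).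
  by apply: ler_mean => T.
(* The constant is 192 = 3 * (32 + 32). *)
rewrite sumr_const card_ord mulr_natl -mulr_sumr big_split /=; lra.
Qed.

End Disjointness.

(** * Protocol executions and the output 0 *)

Section Protocols.
Context {R : realType} {X Y : finType}.
Implicit Types (t : ptree R X Y) (x : X) (y : Y).

Lemma exec_prob_ge0 t x y e : is_protocol t -> 0 <= exec_prob t x y e.
Proof.
elim: t e => [L|L|p0 p1 l IHl r IHr|q0 q1 l IHl r IHr] [|b e] //=.
- by case=> /(_ x)[_ _ ?] _ _; lra.
- by case=> /(_ x)[/andP[? _] /andP[? _] _] /IHl ? /IHr ?; case: b; rewrite mulr_ge0.
- by case=> /(_ y)[_ _ ?] _ _; lra.
- by case=> /(_ y)[/andP[? _] /andP[? _] _] /IHl ? /IHr ?; case: b; rewrite mulr_ge0.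
Qed.

Lemma exec_value_ge0 t x y e : is_protocol t -> 0 <= exec_value t x y e.
Proof.
elim: t e => [L|L|p0 p1 l IHl r IHr|q0 q1 l IHl r IHr] [|b e] //=.
- by case=> _ /IHl ? /IHr ?; case: b.
- by case=> _ /IHl ? /IHr ?; case: b.
Qed.

Lemma sum_exec_prob t x y : \sum_(e <- executions t) exec_prob t x y e = 1.
Proof.
elim: t => [L|L|p0 p1 l IHl r IHr|q0 q1 l IHl r IHr] /=; rewrite ?big_seq1 //;
  rewrite big_cons big_cat !big_map /= -!mulr_sumr IHl IHr; ring.
Qed.

(** Executions are the nodes of a binary tree; the strict inequality absorbs the root in the
    induction. *)
Lemma size_executions t : (size (executions t) < 2 ^ (height t).+1)%N.
Proof.
elim: t => [L|L|p0 p1 l IHl r IHr|q0 q1 l IHl r IHr] //=;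
  rewrite size_cat !size_map expnS mul2n -addnn;
  set h := maxn _ _;
  have hl : (2 ^ (height l).+1 <= 2 ^ h.+1)%N by rewrite leq_exp2l // ltnS leq_maxl.
all: have hr : (2 ^ (height r).+1 <= 2 ^ h.+1)%N by rewrite leq_exp2l // ltnS leq_maxr.
all: have := leq_add (leq_trans IHl hl) (leq_trans IHr hr).
all: by rewrite addSn addnS.
Qed.

(** Each transition depends on one input only and is absorbed into the factor of that side; so is
    the test at a leaf for value 0. *)
Lemma Pr_zero_factor t : is_protocol t ->
  exists (F : seq bool -> X -> R) (G : seq bool -> Y -> R),
    [/\ forall e x, 0 <= F e x, forall e y, 0 <= G e y &
      forall e x y, F e x * G e y =
        if exec_value t x y e == 0 then exec_prob t x y e else 0].
Proof.
elim: t => [L|L|p0 p1 l IHl r IHr|q0 q1 l IHl r IHr] /=.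
- move=> _.
  exists (fun e x => if (e == [::]) && (L x == 0) then 1 else 0), (fun=> fun=> 1).
  split=> [e x|//|[|b e] x y] //=; first by case: ifP.
    by rewrite mulr1.
  by rewrite mul0r eqxx.
- move=> _.
  exists (fun=> fun=> 1), (fun e y => if (e == [::]) && (L y == 0) then 1 else 0).
  split=> [//|e y|[|b e] x y] //=; first by case: ifP.
    by rewrite mul1r.
  by rewrite mulr0 eqxx.
- case=> p01 /IHl[Fl [Gl [Fl0 Gl0 FGl]]] /IHr[Fr [Gr [Fr0 Gr0 FGr]]].
  exists (fun e x => match e with
      | [::] => 1 - p0 x - p1 x
      | b :: e' => if b then p1 x * Fr e' x else p0 x * Fl e' x end),
    (fun e y => match e with
      | [::] => 1
      | b :: e' => if b then Gr e' y else Gl e' y end).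
  split=> [[|[] e] x|[|[] e] y|[|[] e] x y] //=; have [] := p01 x.
  + by move=> _ _ ?; lra.
  + by move=> _ /andP[? _] _; rewrite mulr_ge0.
  + by move=> /andP[? _] _ _; rewrite mulr_ge0.
  + by rewrite mulr1 eqxx.
  + by rewrite -mulrA FGr; case: ifP; rewrite ?mulr0.
  + by rewrite -mulrA FGl; case: ifP; rewrite ?mulr0.
- case=> q01 /IHl[Fl [Gl [Fl0 Gl0 FGl]]] /IHr[Fr [Gr [Fr0 Gr0 FGr]]].
  exists (fun e x => match e with
      | [::] => 1
      | b :: e' => if b then Fr e' x else Fl e' x end),
    (fun e y => match e with
      | [::] => 1 - q0 y - q1 y
      | b :: e' => if b then q1 y * Gr e' y else q0 y * Gl e' y end).
  split=> [[|[] e] x|[|[] e] y|[|[] e] x y] //=; have [] := q01 y.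
  + by move=> _ _ ?; lra.
  + by move=> _ /andP[? _] _; rewrite mulr_ge0.
  + by move=> /andP[? _] _ _; rewrite mulr_ge0.
  + by rewrite mul1r eqxx.
  + by rewrite mulrCA FGr; case: ifP; rewrite ?mulr0.
  + by rewrite mulrCA FGl; case: ifP; rewrite ?mulr0.
Qed.

Lemma Pr_zero t x y :
  \sum_(e <- executions t)
    (if exec_value t x y e == 0 then exec_prob t x y e else 0) =
  1 - exec_Pr t x y (fun e => exec_value t x y e != 0).
Proof.
rewrite -big_mkcond -(sum_exec_prob t x y) /exec_Pr.
by rewrite [in RHS](bigID (fun e => exec_value t x y e == 0)) /= addrK.
Qed.

(** A vanishing sum of nonnegative terms has only zero terms, so executions of nonzero value have
    probability 0. *)
Lemma Pr_nonzero_eq0 t x y : is_protocol t ->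
  exec_E t x y (exec_value t x y) = 0 ->
  exec_Pr t x y (fun e => exec_value t x y e != 0) = 0.
Proof.
move=> pt /eqP; rewrite /exec_E psumr_eq0; last first.
  by move=> e _; rewrite mulr_ge0 ?exec_prob_ge0 ?exec_value_ge0.
move=> /allP zero; rewrite /exec_Pr big_seq_cond big1 // => e /andP[/zero /=].
by rewrite mulf_eq0 => /orP[/eqP|->].
Qed.

Lemma Pr_nonzero_ge t S x y : is_protocol t -> computes_in_expectation t S ->
    S x y != 0 ->
  1 - exec_Var t x y (fun e => exec_value t x y e / S x y) <=
    exec_Pr t x y (fun e => exec_value t x y e != 0).
Proof.
move=> pt tS Sxy.
suff : \sum_(e <- executions t)
    (if exec_value t x y e == 0 then exec_prob t x y e else 0) <=
    exec_Var t x y (fun e => exec_value t x y e / S x y) by rewrite Pr_zero; lra.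
have E1 : exec_E t x y (fun e => exec_value t x y e / S x y) = 1.
  rewrite /exec_E; under eq_bigr do rewrite mulrA.
  by rewrite -mulr_suml -/(exec_E _ _ _ _) tS divff.
rewrite /exec_Var E1; apply: ler_sum => e _; case: eqP => [->|_].
  by rewrite mul0r sub0r sqrrN expr1n mulr1.
by rewrite mulr_ge0 ?exec_prob_ge0 ?sqr_ge0.
Qed.

Lemma height_bound n S t p : (forall x y, 0 <= S x y) -> embeds_DISJ n S ->
    is_protocol t -> computes_in_expectation t S ->
    (forall x y, 0 < S x y ->
      p <= exec_Pr t x y (fun e => exec_value t x y e != 0)) ->
  n%:R * p <= 384 * (height t)%:R.
Proof.
move=> S0 [alpha [beta SD]] pt tS Sp.
have [F [G [F0 G0 FG]]] := Pr_zero_factor pt.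
have sumFG x y : \sum_(e <- executions t) F e x * G e y =
    1 - exec_Pr t x y (fun e => exec_value t x y e != 0).
  by rewrite -Pr_zero; apply: eq_bigr.
have := @unique_disjointness_bound R n _ (executions t)
  (fun e A => F e (alpha A)) (fun e B => G e (beta B)) p.
move=> /(_ (fun _ _ => F0 _ _) (fun _ _ => G0 _ _)) H.
apply: le_trans (H _ _) _ => [A B AB|A B i AB|].
- rewrite sumFG Pr_nonzero_eq0 ?subr0 // tS; apply/SD.
  by rewrite /DISJ AB eqxx.
- rewrite sumFG; rewrite lerD2l lerN2.
  apply: Sp; rewrite lt_def S0 andbT; apply/eqP => /SD; rewrite /DISJ AB.
  have /negbTE -> : [set i] != set0 by apply/set0Pn; exists i; rewrite set11.
  by move/eqP; rewrite eq_sym oner_eq0.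
(* For height [h >= 1] the logarithm is at most [(h + 1) ln 2 <= h + 1 <= 2 h]; for [h = 0] there is
   at most one execution. Hence 384 = 192 * 2. *)
suff : ln (size (executions t))%:R <= 2 * (height t)%:R :> R by lra.
have ln2 : ln 2 <= 1 :> R by have := @ln_leB1 R 2; lra.
have [h0|h_gt0] := posnP (height t).
  rewrite h0 mulr0; apply: ln_le0; rewrite lern1.
  by have := size_executions t; rewrite h0.
apply: (@le_trans _ _ (ln (2 ^+ (height t).+1))).
  have s_gt0 : (0 < size (executions t))%N by case: (t).
  rewrite ler_ln ?posrE ?ltr0n ?exprn_gt0 // -natrX ler_nat ltnW //.
  exact: size_executions.
rewrite lnXn // -[ln 2 *+ _]mulr_natr.
apply: (@le_trans _ _ (1 * (height t).+1%:R)); first by rewrite ler_wpM2r.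
by rewrite mul1r -natrM ler_nat mul2n -addnn -addn1 leq_add2l.
Qed.

End Protocols.

Theorem theorem7 (R : realType) :
  exists c : R, 0 < c /\
    forall (n : nat) (X Y : finType) (S : X -> Y -> R) (t : ptree R X Y),
      (forall x y, 0 <= S x y) ->
      embeds_DISJ n S ->
      is_protocol t ->
      computes_in_expectation t S ->
      (forall p : R,
         (forall x y, 0 < S x y ->
            p <= exec_Pr t x y (fun e => exec_value t x y e != 0)) ->
         c * (n%:R * p) <= (height t)%:R) /\
      c * (n%:R * (1 - normalized_variance t S)) <= (height t)%:R.
Proof.
exists (1 / 384); split=> [|n X Y S t S0 SD pt tS]; first by lra.
have bound p : (forall x y, 0 < S x y ->
    p <= exec_Pr t x y (fun e => exec_value t x y e != 0)) ->
    1 / 384 * (n%:R * p) <= (height t)%:R.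
  by move=> /(height_bound S0 SD pt tS); lra.
split=> //; apply: bound => x y Sxy.
apply: le_trans (Pr_nonzero_ge pt tS (lt0r_neq0 Sxy)).
rewrite lerD2l lerN2 /normalized_variance.
apply: (@le_bigmax_cond _ _ _ _ (x, y)).
exact: lt0r_neq0.
Qed.
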